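(* $\oplus\mathbf{P}\subseteq\mathbf{NP}^{\mathbf{MNS}}$.
   Context: For a polynomial $p$, a polynomial-time computable predicate $R$ and input $x$, write $N(x)=|\{y : |y|=p(|x|)\wedge R(x,y)\}|$. A language $L$ is in $\oplus\mathbf{P}$ if there exist $p,R$ such that for all $x$: $x\in L\iff N(x)$ is odd. A language $L$ is in $\mathbf{MNS}$ if there exist $p,R$ such that for all $x$: $x\in L\iff N(x)=2^t-1$ for some $t\in\{1,2,3,\dots\}$. $\mathbf{NP}^{\mathbf{MNS}}$ denotes the class of languages decided by nondeterministic polynomial-time oracle Turing machines with an oracle for some language in $\mathbf{MNS}$. *)

(* Defs.v *)
From HB Require Import structures.
From mathcomp Require Import all_boot all_order all_algebra.

Set Implicit Arguments.
Unset Strict Implicit.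
Unset Printing Implicit Defensive.

Definition word := seq bool.
Definition language := word -> Prop.
Definition complexity_class := language -> Prop.

Definition peval (p : {poly nat}) (n : nat) : nat := (p.[n])%R.

(* [W] is the set of machine-specific work symbols; [Sep] separates the two
   components of a pair given as input. *)
Inductive symbol (W : Type) : Type :=
  | Blank
  | Sep
  | Bit of bool
  | Work of W.
Arguments Blank {W}.
Arguments Sep {W}.
Arguments Bit {W}.

Inductive move := MoveL | Stay | MoveR.

Record tape (W : Type) := Tape { cells : int -> symbol W; pos : int }.

Definition read (W : Type) (t : tape W) : symbol W := cells t (pos t).

Definition shift (m : move) (i : int) : int :=
  match m with
  | MoveL => (i - 1)%R
  | Stay => i
  | MoveR => (i + 1)%R
  end.

Definition write_move (W : Type) (a : symbol W * move) (t : tape W) : tape W :=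
  Tape (fun i => if i == pos t then a.1 else cells t i) (shift a.2 (pos t)).

Definition tape_of (W : Type) (s : seq (symbol W)) : tape W :=
  Tape (fun i => if i is Posz n then nth Blank s n else Blank) 0%R.

Definition word_symbols (W : Type) (x : word) : seq (symbol W) :=
  [seq Bit b | b <- x].

Definition pair_symbols (W : Type) (x y : word) : seq (symbol W) :=
  word_symbols W x ++ Sep :: word_symbols W y.

(* [K] indexes the tapes, [Q] is the state set. *)
Record config (Q K : finType) (W : Type) :=
  Config { state : Q; tapes : K -> tape W }.

Definition scan (Q K : finType) (W : Type) (c : config Q K W) :
    {ffun K -> symbol W} :=
  [ffun k => read (tapes c k)].

Definition update (Q K : finType) (W : Type) (c : config Q K W)
    (q : Q) (a : {ffun K -> symbol W * move}) : config Q K W :=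
  Config q (fun k => write_move (a k) (tapes c k)).

Definition initial (Q K : finType) (W : Type) (q0 : Q) (k0 : K)
    (s : seq (symbol W)) : config Q K W :=
  Config q0 (fun k => if k == k0 then tape_of s else tape_of [::]).

(* [dverdict q] is [None] when [q] is not halting, and otherwise tells whether
   [q] accepts or rejects. *)
Record dtm := DTM {
  dstate : finType;
  dtape : finType;
  dwork : finType;
  dstart : dstate;
  dinput : dtape;
  dverdict : dstate -> option bool;
  dtrans : dstate -> {ffun dtape -> symbol dwork} ->
           dstate * {ffun dtape -> symbol dwork * move}
}.

Definition dconfig (M : dtm) := config (dstate M) (dtape M) (dwork M).

Definition dstep (M : dtm) (c : dconfig M) : dconfig M :=
  if dverdict (state c) is Some _ then c
  else let qa := dtrans (state c) (scan c) in update c qa.1 qa.2.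

(* The result is [Some b] iff [M] has halted within [n] steps with answer [b],
   since halting configurations are fixed by [dstep]. *)
Definition drun (M : dtm) (s : seq (symbol (dwork M))) (n : nat) :
    option bool :=
  dverdict (state (iter n (@dstep M) (initial (dstart M) (dinput M) s))).

Definition polytime_predicate (R : word -> word -> bool) : Prop :=
  exists (M : dtm) (q : {poly nat}), forall x y : word,
    drun (pair_symbols (dwork M) x y) (peval q (size x + size y)) =
    Some (R x y).

(* [otrans] is a relation between finite sets.  A query is made by entering
   [oquery]; the answer is given by the next state, [oyes] or [ono]. *)
Record ontm := ONTM {
  ostate : finType;
  otape : finType;
  owork : finType;
  ostart : ostate;
  oinput : otape;
  oquerytape : otape;
  oquery : ostate;
  oyes : ostate;
  ono : ostate;
  overdict : ostate -> option bool;
  otrans : ostate -> {ffun otape -> symbol owork} ->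
           ostate -> {ffun otape -> symbol owork * move} -> Prop
}.

Definition oconfig (M : ontm) := config (ostate M) (otape M) (owork M).

(* The queried word is the maximal block of bits starting at cell 0. *)
Definition query_word (W : Type) (t : tape W) (w : word) : Prop :=
  (forall n, n < size w -> cells t (Posz n) = Bit (nth false w n)) /\
  (forall b, cells t (Posz (size w)) <> Bit b).

Inductive ostep (A : language) (M : ontm) (c : oconfig M) :
    oconfig M -> Prop :=
  | OWork q a of
      overdict (state c) = None & state c <> oquery M &
      otrans (state c) (scan c) q a :
      ostep A c (update c q a)
  | OYes w of
      overdict (state c) = None & state c = oquery M &
      query_word (tapes c (oquerytape M)) w & A w :
      ostep A c (Config (oyes M) (tapes c))
  | ONo w of
      overdict (state c) = None & state c = oquery M &
      query_word (tapes c (oquerytape M)) w & ~ A w :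
      ostep A c (Config (ono M) (tapes c)).

Inductive osteps (A : language) (M : ontm) (c : oconfig M) :
    nat -> oconfig M -> Prop :=
  | osteps0 : osteps A c 0 c
  | ostepsS n c1 c2 of osteps A c n c1 & ostep A c1 c2 :
      osteps A c n.+1 c2.

Definition oinit (M : ontm) (x : word) : oconfig M :=
  initial (ostart M) (oinput M) (word_symbols (owork M) x).

(* Every computation path is bounded; a path that ends without reaching an
   accepting state (by rejecting or for lack of a transition) does not accept. *)
Definition runs_in_time (A : language) (M : ontm) (q : {poly nat}) : Prop :=
  forall (x : word) (n : nat) (c : oconfig M),
    osteps A (oinit M x) n c -> n <= peval q (size x).

Definition accepts (A : language) (M : ontm) (x : word) : Prop :=
  exists (n : nat) (c : oconfig M),
    osteps A (oinit M x) n c /\ overdict (state c) = Some true.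

Definition witness_count (p : {poly nat}) (R : word -> word -> bool)
    (x : word) : nat :=
  #|[set y : (peval p (size x)).-tuple bool | R x y]|.

Definition ParityP : complexity_class := fun L =>
  exists (p : {poly nat}) (R : word -> word -> bool),
    polytime_predicate R /\
    forall x, L x <-> odd (witness_count p R x).

Definition MNS : complexity_class := fun L =>
  exists (p : {poly nat}) (R : word -> word -> bool),
    polytime_predicate R /\
    forall x, L x <-> exists t : nat, 1 <= t /\ witness_count p R x = 2 ^ t - 1.

Definition NP_oracle (C : complexity_class) : complexity_class := fun L =>
  exists A : language, C A /\
  exists (M : ontm) (q : {poly nat}),
    runs_in_time A M q /\ forall x, L x <-> accepts A M x.

(* Main.v *)
(** [N] is odd iff [N + m = 2 ^ t - 1] for some even [m] and some [t >= 1], and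
    such an [m] exists below [2 ^ p] as soon as [N] is odd and at most [2 ^ p].
    The oracle machine therefore guesses a word [g] of length [p(|x|)] that
    encodes [m], and asks a single question about the pair [(x, g)].  The
    witnesses of the oracle language are [0 ^ (2 |x|) c v]: those with [c = 0]
    are the witnesses of [x], and those with [c = 1] are the [v] below [g] in a
    comparison that ignores the first position, hence come in pairs and add the
    even number [m] to the count.  The exact length [p(|x|)] is produced by
    nested loops over copies of [x] that follow the Horner scheme of [p]. *)

From HB Require Import structures.
Require Import Defs.
From mathcomp Require Import all_boot all_order all_algebra.
From mathcomp Require Import zify.
From Stdlib Require Import FunctionalExtensionality.

Set Implicit Arguments.
Unset Strict Implicit.
Unset Printing Implicit Defensive.

Import GRing.Theory.

(** * Tapes *)

#[local] Arguments read : simpl never.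
#[local] Arguments write_move : simpl never.

(** Positions are integers because the machines detect the left end of a word by stepping onto the
    blank cell -1. *)
Definition tape_at (W : Type) (s : seq (symbol W)) (i : int) : tape W :=
  Tape (cells (tape_of s)) i.

Definition step_head (W : Type) (m : move) (t : tape W) : tape W :=
  write_move (read t, m) t.

Lemma read_tape_at (W : Type) (s : seq (symbol W)) (n : nat) :
  read (tape_at s n) = nth Blank s n.
Proof. by []. Qed.

Lemma read_tape_at_end (W : Type) (s : seq (symbol W)) :
  read (tape_at s (size s)) = Blank.
Proof. by rewrite read_tape_at nth_default. Qed.

Lemma step_headE (W : Type) (m : move) (s : seq (symbol W)) (i : int) :
  step_head m (tape_at s i) = tape_at s (shift m i).
Proof.
rewrite /step_head /write_move /tape_at /=; congr Tape.
by apply: functional_extensionality => j; case: eqP => // ->.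
Qed.

Lemma step_head_right (W : Type) (s : seq (symbol W)) (n : nat) :
  step_head MoveR (tape_at s n) = tape_at s n.+1.
Proof. by rewrite step_headE /= -addn1 PoszD. Qed.

Lemma write_end (W : Type) (s : seq (symbol W)) (a : symbol W) :
  write_move (a, MoveR) (tape_at s (size s)) =
  tape_at (rcons s a) (size (rcons s a)).
Proof.
rewrite /write_move /tape_at /= size_rcons -addn1 PoszD; congr Tape.
apply: functional_extensionality => -[j|j] //=.
by rewrite nth_rcons eqz_nat; case: ltngtP => // h; rewrite nth_default // ltnW.
Qed.

Lemma write_stay (W : Type) (t : tape W) : write_move (read t, Stay) t = t.
Proof.
case: t => c i; rewrite /write_move /=; congr Tape.
by apply: functional_extensionality => j; case: eqP => // ->.
Qed.

Lemma write_left (W : Type) (s : seq (symbol W)) (i : int) :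
  write_move (read (tape_at s i), MoveL) (tape_at s i) = tape_at s (i - 1)%R.
Proof. exact: (step_headE MoveL). Qed.

Lemma write_right_blank (W : Type) (s : seq (symbol W)) :
  write_move (Blank, MoveR) (tape_at s (-1)%R) = tape_at s 0%R.
Proof. exact: (step_headE MoveR s (-1)%R). Qed.

(** Cutting the contents at the head turns a scan to the right into an induction on [post]; with
    [post] empty the tape is about to be extended. *)
Definition tape_zip (W : Type) (pre post : seq (symbol W)) : tape W :=
  tape_at (pre ++ post) (size pre).

Lemma read_zip_nil (W : Type) (s : seq (symbol W)) :
  read (tape_zip s [::]) = Blank.
Proof. by rewrite /tape_zip cats0 read_tape_at_end. Qed.

Lemma read_zip_cons (W : Type) (pre post : seq (symbol W)) a :
  read (tape_zip pre (a :: post)) = a.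
Proof. by rewrite /tape_zip read_tape_at nth_cat ltnn subnn. Qed.

Lemma zip_right (W : Type) (pre post : seq (symbol W)) a :
  write_move (a, MoveR) (tape_zip pre (a :: post)) =
  tape_zip (rcons pre a) post.
Proof.
rewrite -{1}(read_zip_cons pre post a) [LHS]step_head_right.
by rewrite /tape_zip cat_rcons size_rcons.
Qed.

Lemma zip_append (W : Type) (s : seq (symbol W)) a :
  write_move (a, MoveR) (tape_zip s [::]) = tape_zip (rcons s a) [::].
Proof. by rewrite /tape_zip !cats0 write_end. Qed.

Lemma zip_left_end (W : Type) (s : seq (symbol W)) :
  write_move (read (tape_zip s [::]), MoveL) (tape_zip s [::]) =
  tape_at s ((size s)%:Z - 1)%R.
Proof. by rewrite /tape_zip cats0 write_left. Qed.

Definition nonblank (W : Type) (a : symbol W) : bool :=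
  if a is Blank then false else true.

Lemma all_nonblank_word (W : Type) (x : word) :
  all (@nonblank W) (word_symbols W x).
Proof. by elim: x. Qed.

Lemma word_symbols_rcons (W : Type) (x : word) b :
  word_symbols W (rcons x b) = rcons (word_symbols W x) (Bit b).
Proof. exact: map_rcons. Qed.

Lemma subz1 n : (n.+1%:Z - 1 = n)%R.
Proof. by rewrite -addn1 PoszD addrK. Qed.

(** * The comparison set *)

(** Bits are least significant first, so the last differing position decides. On words of equal
    length, [acc = false] gives v < g for the coded numbers and [acc = true] gives v <= g. *)
Fixpoint lt_lsb (acc : bool) (g v : word) : bool :=
  match g, v with
  | a :: g', b :: v' => lt_lsb (if a == b then acc else a) g' v'
  | _, _ => acc
  end.

(* Ignoring the first position makes the number of [v] below [g] even. *)
Definition lt_even (g v : word) : bool :=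
  match g, v with
  | _ :: g', _ :: v' => lt_lsb false g' v'
  | _, _ => false
  end.

Fixpoint val_lsb (g : word) : nat :=
  if g is a :: g' then a + (val_lsb g').*2 else 0.

Fixpoint wcount (k : nat) (P : word -> bool) : nat :=
  if k is k'.+1 then
    wcount k' (fun v => P (false :: v)) + wcount k' (fun v => P (true :: v))
  else P [::].

Lemma eq_wcount k P Q :
  (forall v, size v = k -> P v = Q v) -> wcount k P = wcount k Q.
Proof.
elim: k P Q => [|k IH] P Q PQ /=; first by rewrite PQ.
by congr (_ + _); apply: IH => v sv; apply: PQ; rewrite /= sv.
Qed.

Lemma wcount0 k : wcount k (fun=> false) = 0.
Proof. by elim: k => //= k ->. Qed.

Lemma wcount_le k P : wcount k P <= 2 ^ k.
Proof.
elim: k P => [|k IH] P /=; first by case: (P _).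
by rewrite expnS mul2n -addnn leq_add.
Qed.

Lemma card_tuple_wcount k (P : word -> bool) :
  #|[set y : k.-tuple bool | P y]| = wcount k P.
Proof.
rewrite -sum1_card (eq_bigl (fun y : k.-tuple bool => P y)); last first.
  by move=> y; rewrite inE.
rewrite big_mkcond /=.
elim: k P => [|k IH] P /=.
  rewrite (big_pred1 [tuple]) /=; first by case: (P _).
  by move=> y; rewrite (tuple0 y); apply/esym/eqP/val_inj.
rewrite (reindex (fun bt : bool * k.-tuple bool => [tuple of bt.1 :: bt.2])) /=.
  rewrite -(pair_big xpredT xpredT
    (fun b (t : k.-tuple bool) => if P (b :: t) then 1 else 0)) /=.
  rewrite big_bool /= addnC (IH (fun v => P (true :: v))).
  by rewrite (IH (fun v => P (false :: v))).
exists (fun y => (thead y, [tuple of behead y])) => [[b t] _|y _] /=.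
  by congr pair; apply: val_inj.
by rewrite [RHS]tuple_eta; apply: val_inj.
Qed.

(** A number has as many numbers below it as its value; [acc] adds the word [g] itself. *)
Lemma wcount_lt_lsb acc g :
  wcount (size g) (lt_lsb acc g) = acc + val_lsb g.
Proof.
elim: g acc => [|a g IH] acc /=; first by rewrite addn0.
rewrite !IH; case: a acc => [] [] /=; lia.
Qed.

Lemma wcount_lt_even a g :
  wcount (size g).+1 (lt_even (a :: g)) = (val_lsb g).*2.
Proof. by rewrite /= !wcount_lt_lsb !add0n addnn. Qed.

Lemma val_lsb_onto k m : m < 2 ^ k -> exists2 g, size g = k & val_lsb g = m.
Proof.
elim: k m => [|k IH] m; first by case: m => // _; exists [::].
rewrite expnS => hm; have [|g sg vg] := IH m./2; first by lia.
exists (odd m :: g); first by rewrite /= sg.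
by rewrite /= vg odd_double_half.
Qed.

(** An even addend preserves parity, and 2^t - 1 is odd for t >= 1. Conversely an odd N is completed
    to 2^k - 1, or to 1 when k = 0. *)
Lemma odd_iff_lt_even_completion k N : N <= 2 ^ k ->
  odd N <-> exists g, size g = k /\
    exists t, 1 <= t /\ N + wcount k (lt_even g) = 2 ^ t - 1.
Proof.
move=> leN; split=> [oN|[g [sg [[|t] [// _ eq]]]]]; last first.
  have : odd (2 ^ t.+1 - 1) by rewrite oddB ?expn_gt0 // oddX.
  rewrite -eq oddD; case: g k sg {leN eq} => [|a g] k <-.
    by rewrite /= addbF.
  by rewrite wcount_lt_even odd_double addbF.
(* For k = 0 the count is N = 1, the comparison set is empty and t = 1. *)
case: k leN => [|k] leN.
  by exists [::]; split=> //; exists 1; split=> //=; move: N leN oN => [|[|]].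
(* The bound 2^(k+1) is even, so an odd N lies strictly below it and its distance to 2^(k+1) - 1 is
   even. *)
have ltN : N < 2 ^ k.+1.
  rewrite ltn_neqAle leN andbT; apply: contraTneq oN => ->.
  by rewrite oddX.
have [|g sg vg] := @val_lsb_onto k (2 ^ k.+1 - 1 - N)./2.
  by move: ltN; rewrite expnS; lia.
exists (false :: g); split; first by rewrite /= sg.
exists k.+1; split=> //; rewrite -sg wcount_lt_even vg sg.
by move: ltN; rewrite expnS; lia.
Qed.

(** * The oracle predicate *)

(** Self-delimiting: [true] announces a letter and [false] the end, so [x] can be recovered from the
    front of a longer word. *)
Fixpoint code (x : word) : word :=
  if x is b :: x' then true :: b :: code x' else [:: false].

Fixpoint parse (w : word) : option (word * word) :=
  match w with
  | true :: b :: w' => omap (fun xg => (b :: xg.1, xg.2)) (parse w')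
  | false :: g => Some ([::], g)
  | _ => None
  end.

Fixpoint skip_zeros (k : nat) (y : word) : option word :=
  if k is k'.+1 then if y is false :: y' then skip_zeros k' y' else None
  else Some y.

(** The 2|x| zeros and the choice bit [c] take exactly the length 2|x| + 1 of [code x]; a witness as
    long as [w] therefore leaves |g| letters for [v]. *)
Definition padded (R : word -> word -> bool) (w y : word) : bool :=
  if parse w is Some (x, g) then
    if skip_zeros (size x).*2 y is Some (c :: v) then
      if c then lt_even g v else R x v
    else false
  else false.

Lemma parse_code x g : parse (code x ++ g) = Some (x, g).
Proof. by elim: x => //= b x ->. Qed.

Lemma size_code x : size (code x) = (size x).*2.+1.
Proof. by elim: x => //= b x ->. Qed.

(** Among the 2^m prefixes only the one made of zeros contributes. *)
Lemma wcount_skip_zeros m k (F : word -> bool) :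
  wcount (m + k) (fun y => if skip_zeros m y is Some v then F v else false) =
  wcount k F.
Proof.
elim: m => [|m IH] /=; first exact: eq_wcount.
by rewrite IH wcount0 addn0.
Qed.

Lemma wcount_padded R x g :
  wcount (size (code x ++ g)) (padded R (code x ++ g)) =
  wcount (size g) (R x) + wcount (size g) (lt_even g).
Proof.
rewrite size_cat size_code addSnnS.
rewrite (eq_wcount (Q := fun y =>
  if skip_zeros (size x).*2 y is Some v then
    (if v is c :: v' then if c then lt_even g v' else R x v' else false)
  else false)); last first.
  by move=> y _; rewrite /padded parse_code; case: (skip_zeros _ _) => [[]|].
by rewrite (wcount_skip_zeros _ _ (fun v =>
    if v is c :: v' then if c then lt_even g v' else R x v' else false)).
Qed.

(** The coefficients are natural numbers, so Horner evaluation is monotone. *)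
Lemma peval_leq (p : {poly nat}) m n : m <= n -> peval p m <= peval p n.
Proof.
move=> mn; rewrite /peval /horner; elim: (polyseq p) => //= a s IH.
by rewrite leq_add // leq_mul.
Qed.

(** * Deterministic decision of the oracle predicate *)

(** A budget rather than an exact time: the machine is executed symbolically, one unit per step, and
    [halts_leq] absorbs the slack. *)
Definition halts (M : dtm) (b : nat) (c : dconfig M) (r : bool) : Prop :=
  exists2 t, t <= b & dverdict (state (iter t (@dstep M) c)) = Some r.

Lemma halts_now (M : dtm) (b : nat) (c : dconfig M) r :
  dverdict (state c) = Some r -> halts b c r.
Proof. by move=> h; exists 0. Qed.

Lemma halts_step (M : dtm) (b : nat) (c : dconfig M) r :
  halts b (dstep c) r -> halts b.+1 c r.
Proof. by case=> t tb h; exists t.+1 => //; rewrite iterSr. Qed.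

Lemma halts_leq (M : dtm) (b b' : nat) (c : dconfig M) r :
  b <= b' -> halts b c r -> halts b' c r.
Proof. by move=> bb [t tb h]; exists t => //; apply: leq_trans bb. Qed.

Lemma halts_run (M : dtm) b (c : dconfig M) r :
  halts b c r -> dverdict (state (iter b (@dstep M) c)) = Some r.
Proof.
case=> t tb h; rewrite -(subnK tb) iterD.
elim: (b - t) => //= k IH.
by rewrite {1}/dstep IH.
Qed.

Inductive phase :=
  | ReadFlag | ReadBit | ReadGuess | RewindAux | SkipZeros | CmpFirst
  | CmpRest of bool | CopyWitness | RewindSim | Halt of bool.

Definition phase_enc (s : phase) : 'I_8 + (bool + bool) :=
  match s with
  | ReadFlag => inl (inord 0)
  | ReadBit => inl (inord 1)
  | ReadGuess => inl (inord 2)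
  | RewindAux => inl (inord 3)
  | SkipZeros => inl (inord 4)
  | CmpFirst => inl (inord 5)
  | CopyWitness => inl (inord 6)
  | RewindSim => inl (inord 7)
  | CmpRest b => inr (inl b)
  | Halt b => inr (inr b)
  end.

Definition phase_dec (i : 'I_8 + (bool + bool)) : phase :=
  match i with
  | inl i => nth RewindSim [:: ReadFlag; ReadBit; ReadGuess; RewindAux;
                              SkipZeros; CmpFirst; CopyWitness] i
  | inr (inl b) => CmpRest b
  | inr (inr b) => Halt b
  end.

Lemma phase_encK : cancel phase_enc phase_dec.
Proof. by case=> //=; rewrite inordK. Qed.

HB.instance Definition _ := Finite.copy phase (can_type phase_encK).

(** * The machine for the oracle predicate *)

Section PaddedMachine.

Variable M : dtm.
Notation W := (dwork M).
Notation sym := (symbol (dwork M)).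
Notation act := (symbol (dwork M) * move)%type.

(* The three symbols are read on the input tape, on the auxiliary tape (a copy
   of the query word in which the coded [x] is masked by separators) and on the
   input tape of the simulated machine. *)
Definition padded_trans (q : phase) (si sa sm : sym) :
    (phase + dstate M) * (act * act * act) :=
  let keep := ((si, Stay), (sa, Stay), (sm, Stay)) in
  match q with
  | ReadFlag =>
      match si with
      | Bit true => (inl ReadBit, ((si, MoveR), (Sep, MoveR), (sm, Stay)))
      | Bit false => (inl ReadGuess, ((si, MoveR), (si, MoveR), (sm, Stay)))
      | _ => (inl (Halt false), keep)
      end
  | ReadBit =>
      match si with
      | Bit _ => (inl ReadFlag, ((si, MoveR), (Sep, MoveR), (si, MoveR)))
      | _ => (inl (Halt false), keep)
      end
  | ReadGuess =>
      match si with
      | Bit _ => (inl ReadGuess, ((si, MoveR), (si, MoveR), (sm, Stay)))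
      | _ => (inl RewindAux, ((si, MoveR), (sa, MoveL), (Sep, MoveR)))
      end
  | RewindAux =>
      match sa with
      | Blank => (inl SkipZeros, ((si, Stay), (sa, MoveR), (sm, Stay)))
      | _ => (inl RewindAux, ((si, Stay), (sa, MoveL), (sm, Stay)))
      end
  | SkipZeros =>
      match si, sa with
      | Bit false, Sep =>
          (inl SkipZeros, ((si, MoveR), (sa, MoveR), (sm, Stay)))
      | Bit c, Bit _ =>
          (inl (if c then CmpFirst else CopyWitness),
           ((si, MoveR), (sa, MoveR), (sm, Stay)))
      | _, _ => (inl (Halt false), keep)
      end
  | CmpFirst =>
      match si, sa with
      | Bit _, Bit _ =>
          (inl (CmpRest false), ((si, MoveR), (sa, MoveR), (sm, Stay)))
      | _, _ => (inl (Halt false), keep)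
      end
  | CmpRest acc =>
      match si, sa with
      | Bit b, Bit a =>
          (inl (CmpRest (if a == b then acc else a)),
           ((si, MoveR), (sa, MoveR), (sm, Stay)))
      | _, _ => (inl (Halt acc), keep)
      end
  | CopyWitness =>
      match si with
      | Bit _ => (inl CopyWitness, ((si, MoveR), (sa, Stay), (si, MoveR)))
      | _ => (inl RewindSim, ((si, Stay), (sa, Stay), (sm, MoveL)))
      end
  | RewindSim =>
      match sm with
      | Blank => (inr (dstart M), ((si, Stay), (sa, Stay), (sm, MoveR)))
      | _ => (inl RewindSim, ((si, Stay), (sa, Stay), (sm, MoveL)))
      end
  | Halt _ => (inl q, keep)
  end.

(** The preparation writes [x], a separator and [v] on the input tape of [M], so that control passes
    to [M] and its verdict is taken over. *)
Definition padded_dtm : dtm := {|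
  dstate := (phase + dstate M)%type;
  dtape := (bool + dtape M)%type;
  dwork := dwork M;
  dstart := inl ReadFlag;
  dinput := inl true;
  dverdict := fun q =>
    match q with
    | inl (Halt b) => Some b
    | inl _ => None
    | inr q => dverdict q
    end;
  dtrans := fun q s =>
    match q with
    | inl q =>
        let r := padded_trans q (s (inl true)) (s (inl false))
                   (s (inr (dinput M))) in
        (r.1, [ffun k =>
           match k with
           | inl true => r.2.1.1
           | inl false => r.2.1.2
           | inr k => if k == dinput M then r.2.2 else (s (inr k), Stay)
           end])
    | inr q =>
        let r := dtrans q [ffun k => s (inr k)] in
        (inr r.1, [ffun k =>
           match k with
           | inl b => (s (inl b), Stay)
           | inr k => r.2 k
           end])
    end
|}.

(** * Correctness and cost of the machine, phase by phase *)

Definition pconf (q : phase + dstate M) (ti ta tm : tape W) :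
    dconfig padded_dtm :=
  @Config (dstate padded_dtm) (dtape padded_dtm) (dwork padded_dtm) q
    (fun k => match k with
     | inl true => ti
     | inl false => ta
     | inr k => if k == dinput M then tm else tape_of [::]
     end).

Lemma pconf_step q ti ta tm :
  (if q is Halt _ then false else true) ->
  let r := padded_trans q (read ti) (read ta) (read tm) in
  dstep (pconf (inl q) ti ta tm) =
  pconf r.1 (write_move r.2.1.1 ti) (write_move r.2.1.2 ta)
    (write_move r.2.2 tm).
Proof.
move=> nh r.
have -> : dstep (pconf (inl q) ti ta tm) =
  let qa := @dtrans padded_dtm (inl q) (scan (pconf (inl q) ti ta tm)) in
  update (pconf (inl q) ti ta tm) qa.1 qa.2 by case: q nh r.
rewrite /= !ffunE /= eqxx -/r /update /pconf; congr Config.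
apply: functional_extensionality => -[[]|k]; rewrite !ffunE //=.
case: eqP => // _; exact: write_stay.
Qed.

(** After the hand-over both machines move in lockstep and the two additional tapes stay inert. *)
Lemma halts_simulation b (c : dconfig M) (c' : dconfig padded_dtm) r :
  state c' = inr (state c) ->
  (forall k, tapes c' (inr k) = tapes c k) ->
  halts b c r -> halts b c' r.
Proof.
move=> hs ht [t tb h]; exists t => //.
elim: t c c' hs ht h {tb} => [|t IH] c c' hs ht; first by rewrite /= hs.
rewrite !iterSr; apply: IH; rewrite /dstep hs /=;
  case: (dverdict (state c)) => //=.
- congr inr; congr (fst (dtrans _ _)).
  by apply/ffunP=> k; rewrite !ffunE ht.
- move=> k; rewrite !ffunE ht; congr (write_move (snd (dtrans _ _) k) _).
  by apply/ffunP=> i; rewrite !ffunE ht.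
Qed.

(** From cell n - 1, n moves reach the blank at cell -1 and one more returns to cell 0. A blank
    inside the word would stop the head too early. *)
Lemma halts_rewind_aux b ti tm s n r :
  all (@nonblank W) s -> n <= size s ->
  halts b (pconf (inl SkipZeros) ti (tape_of s) tm) r ->
  halts (b + n.+1) (pconf (inl RewindAux) ti (tape_at s (n%:Z - 1)%R) tm) r.
Proof.
move=> nbs; elim: n => [|n IH] len h.
  rewrite addn1; apply: halts_step; rewrite pconf_step //=.
  by rewrite !write_stay write_right_blank.
rewrite addnS; apply: halts_step; rewrite pconf_step // subz1.
have -> : padded_trans RewindAux (read ti) (read (tape_at s n)) (read tm) =
    (inl RewindAux, ((read ti, Stay), (read (tape_at s n), MoveL),
                     (read tm, Stay))).
  have := all_nthP Blank nbs n len; rewrite read_tape_at.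
  by case: (nth Blank s n).
by rewrite /= !write_stay write_left; apply: IH => //; exact: ltnW.
Qed.

Lemma halts_rewind_sim b ti ta s n r :
  all (@nonblank W) s -> n <= size s ->
  halts b (pconf (inr (dstart M)) ti ta (tape_of s)) r ->
  halts (b + n.+1) (pconf (inl RewindSim) ti ta (tape_at s (n%:Z - 1)%R)) r.
Proof.
move=> nbs; elim: n => [|n IH] len h.
  rewrite addn1; apply: halts_step; rewrite pconf_step //=.
  by rewrite !write_stay write_right_blank.
rewrite addnS; apply: halts_step; rewrite pconf_step // subz1.
have -> : padded_trans RewindSim (read ti) (read ta) (read (tape_at s n)) =
    (inl RewindSim, ((read ti, Stay), (read ta, Stay),
                     (read (tape_at s n), MoveL))).
  have := all_nthP Blank nbs n len; rewrite read_tape_at.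
  by case: (nth Blank s n).
by rewrite /= !write_stay write_left; apply: IH => //; exact: ltnW.
Qed.

(** Copying takes |v| + 1 steps, the last of which notices the end; rewinding over the extended word
    takes |s| + |v| + 1. *)
Lemma halts_copy_witness b pre ta s v r :
  all (@nonblank W) s ->
  (forall ti, halts b (pconf (inr (dstart M)) ti ta
                         (tape_of (s ++ word_symbols W v))) r) ->
  halts (b + (size s + size v).+1 + (size v).+1)
    (pconf (inl CopyWitness) (tape_zip pre (word_symbols W v)) ta
       (tape_zip s [::])) r.
Proof.
elim: v pre s => [|a v IH] pre s nbs h.
  rewrite addn1; apply: halts_step.
  rewrite pconf_step // (read_zip_nil pre) /= !write_stay.
  rewrite zip_left_end addn0.
  by apply: halts_rewind_sim => //; rewrite -[s]cats0; apply: h.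
rewrite addnS; apply: halts_step.
rewrite pconf_step // (read_zip_cons pre) /= !write_stay zip_right zip_append.
rewrite -[size s + _]addSnnS -(size_rcons s (Bit a)); apply: IH.
  by rewrite all_rcons nbs.
by move=> ti; rewrite cat_rcons; apply: h.
Qed.

Lemma halts_cmp_rest pre pa tm acc g v :
  halts (size v).+1
    (pconf (inl (CmpRest acc)) (tape_zip pre (word_symbols W v))
       (tape_zip pa (word_symbols W g)) tm) (lt_lsb acc g v).
Proof.
elim: v g acc pre pa => [|b v IH] [|a g] acc pre pa; apply: halts_step;
  rewrite pconf_step //.
- by rewrite !read_zip_nil; apply: halts_now.
- by rewrite (read_zip_nil pre); apply: halts_now.
- by rewrite (read_zip_nil pa) (read_zip_cons pre); apply: halts_now.
by rewrite !read_zip_cons /= !write_stay !zip_right; apply: IH.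
Qed.

Lemma halts_cmp_first pre pa tm g v :
  halts (size v).+1
    (pconf (inl CmpFirst) (tape_zip pre (word_symbols W v))
       (tape_zip pa (word_symbols W g)) tm) (lt_even g v).
Proof.
case: v g => [|b v] [|a g]; apply: halts_step; rewrite pconf_step //.
- by rewrite !read_zip_nil; apply: halts_now.
- by rewrite (read_zip_nil pre); apply: halts_now.
- by rewrite (read_zip_nil pa) (read_zip_cons pre); apply: halts_now.
rewrite !read_zip_cons /= !write_stay !zip_right; exact: halts_cmp_rest.
Qed.

Lemma halts_read_guess b pre sa s g post r :
  all (@nonblank W) sa ->
  (forall pre', halts b (pconf (inl SkipZeros) (tape_zip pre' post)
     (tape_of (sa ++ word_symbols W g)) (tape_zip (rcons s Sep) [::])) r) ->
  halts (b + (size sa + size g).+1 + (size g).+1)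
    (pconf (inl ReadGuess) (tape_zip pre (word_symbols W g ++ Sep :: post))
       (tape_zip sa [::]) (tape_zip s [::])) r.
Proof.
elim: g pre sa => [|a g IH] pre sa nbs h.
  rewrite addn1; apply: halts_step.
  rewrite pconf_step // (read_zip_cons pre) /= zip_right zip_append.
  rewrite zip_left_end addn0.
  by apply: halts_rewind_aux => //; move: (h (rcons pre Sep)); rewrite cats0.
rewrite addnS; apply: halts_step.
rewrite pconf_step // (read_zip_cons pre) /= !write_stay zip_right zip_append.
rewrite -[size sa + _]addSnnS -(size_rcons sa (Bit a)); apply: IH.
  by rewrite all_rcons nbs.
by move=> pre'; rewrite cat_rcons; apply: h.
Qed.

Variables (R : word -> word -> bool) (q : {poly nat}).
Hypothesis M_decides_R : forall x y : word,
  drun (pair_symbols W x y) (peval q (size x + size y)) = Some (R x y).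

Lemma halts_simulate_witness pre ta x v :
  halts (peval q (size x + size v) + (size x + size v).+2 + (size v).+1)
    (pconf (inl CopyWitness) (tape_zip pre (word_symbols W v)) ta
       (tape_zip (rcons (word_symbols W x) Sep) [::])) (R x v).
Proof.
(* The separator is counted with [x], to match the word that already stands on the simulated
   tape. *)
rewrite -addSn -{2}(size_map (@Bit W) x) -(size_rcons _ Sep).
apply: halts_copy_witness; first by rewrite all_rcons all_nonblank_word.
move=> ti; apply: (@halts_simulation _
  (initial (dstart M) (dinput M) (pair_symbols W x v))) => //.
- by move=> k /=; rewrite /pair_symbols cat_rcons.
- by exists (peval q (size x + size v)); last exact: M_decides_R.
Qed.

(** The separators of the mask act as a unary counter for the required zeros, and the closing
    [false] of the code lines up with the choice bit. Monotonicity of [peval q] lets one budget in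
    [N] cover both branches. *)
Lemma halts_skip_zeros N pre pa x k g y :
  size x + size y <= N ->
  halts (peval q N + 4 * N + 4)
    (pconf (inl SkipZeros) (tape_zip pre (word_symbols W y))
       (tape_zip pa (nseq k Sep ++ Bit false :: word_symbols W g))
       (tape_zip (rcons (word_symbols W x) Sep) [::]))
    (if skip_zeros k y is Some (c :: v) then
       if c then lt_even g v else R x v else false).
Proof.
elim: y N k pre pa => [|c y IH] N k pre pa leN.
  rewrite addnS; apply: halts_step; rewrite pconf_step // (read_zip_nil pre).
  by apply: halts_now; case: k.
case: N leN => [|N] /= leN; first by move: leN; rewrite addnC.
rewrite mulnS addnA !addnS; apply: halts_step; rewrite pconf_step //.
rewrite (read_zip_cons pre); case: k => [|k] /=; rewrite !read_zip_cons.
  have qN : peval q (size x + size y) <= peval q N.+1 by apply: peval_leq; lia.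
  case: c => /=; rewrite !write_stay !zip_right.
    apply: halts_leq (halts_cmp_first _ _ _ _ _); move: leN => /=; lia.
  apply: halts_leq (halts_simulate_witness _ _ _ _); move: leN => /=; lia.
case: c => /=; first exact: halts_now.
rewrite !write_stay !zip_right; apply: halts_leq (IH N _ _ _ _).
  by have := @peval_leq q N N.+1 (leqnSn _); lia.
by move: leN => /=; lia.
Qed.

(** Loop invariant: [x] is the part decoded so far and [w] the rest of the query word. The size of
    [x] is counted twice because of the two separators written per letter. *)
Lemma halts_read_flag N pre x w y :
  size x + size x + size w + size y <= N ->
  halts (size w + (peval q N + 8 * N + 16))
    (pconf (inl ReadFlag)
       (tape_zip pre (word_symbols W w ++ Sep :: word_symbols W y))
       (tape_zip (nseq (size x).*2 Sep) [::])
       (tape_zip (word_symbols W x) [::]))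
    (if parse w is Some (x', g) then
       if skip_zeros (size (x ++ x')).*2 y is Some (c :: v) then
         if c then lt_even g v else R (x ++ x') v
       else false
     else false).
Proof.
(* A round consumes two letters of [w], hence the strong induction on its length. *)
have [m] := ubnP (size w); elim: m w x pre => // m IH [|c w] x pre lew leN.
  rewrite /= add0n addnS; apply: halts_step; rewrite pconf_step //.
  by rewrite (read_zip_cons pre); apply: halts_now.
rewrite /= addSn; apply: halts_step; rewrite pconf_step // (read_zip_cons pre).
case: c lew leN => lew leN /=; rewrite !write_stay zip_right zip_append.
  case: w lew leN => [|b w] lew leN.
    rewrite /= add0n addnS; apply: halts_step; rewrite pconf_step //.
    by rewrite (read_zip_cons (rcons _ _)); apply: halts_now.
  rewrite /= addSn; apply: halts_step; rewrite pconf_step //.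
  rewrite (read_zip_cons (rcons _ _)) /= zip_right !zip_append.
  have -> : rcons (rcons (nseq (size x).*2 Sep) Sep) Sep =
            nseq (size (rcons x b)).*2 (@Sep W).
    rewrite size_rcons -!cats1 -catA -[_ ++ _]/(_ ++ nseq 2 Sep).
    by rewrite -nseqD addn2.
  rewrite -word_symbols_rcons.
  have := IH w (rcons x b)
    (rcons (rcons pre (Bit true)) (Bit b)).
  rewrite size_rcons; move: lew leN => /= lew leN.
  move/(_ ltac:(lia) ltac:(lia)).
  case: (parse w) => [[x' g]|] //=.
  by rewrite cat_rcons.
apply: halts_leq (@halts_read_guess (peval q N + 4 * N + 4)
  _ _ _ w _ _ _ _).
- by rewrite size_rcons size_nseq; move: leN => /=; lia.
- by rewrite all_rcons /= all_nseq orbT.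
move=> pre'; rewrite cats0 cat_rcons.
by apply: (@halts_skip_zeros _ _ [::]); move: leN => /=; lia.
Qed.

Lemma halts_padded w y :
  halts (peval q (size w + size y) + 9 * (size w + size y) + 16)
    (initial (dstart padded_dtm) (dinput padded_dtm) (pair_symbols W w y))
    (padded R w y).
Proof.
have -> : initial (dstart padded_dtm) (dinput padded_dtm) (pair_symbols W w y)
  = pconf (inl ReadFlag) (tape_of (pair_symbols W w y)) (tape_of [::])
      (tape_of [::]).
  rewrite /initial /pconf; congr Config.
  by apply: functional_extensionality => -[[]|k] //=; case: eqP.
have := @halts_read_flag (size w + size y) [::] [::] w y (leqnn _).
by apply: halts_leq; lia.
Qed.

End PaddedMachine.

Lemma polytime_padded (R : word -> word -> bool) :
  polytime_predicate R -> polytime_predicate (padded R).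
Proof.
case=> M [q hM]; exists (padded_dtm M), (q + 9%:P * 'X + 16%:P)%R => w y.
have := halts_run (halts_padded hM w y).
by rewrite /drun /peval !hornerD hornerM !hornerC hornerX.
Qed.

(** * The guessing machine *)

(* [Enter d r] still has to guess [r] bits before looping over counter [d]. *)
Inductive gphase (D B : nat) :=
  | CopyFlag | CopyBit | RewindAll
  | Enter of 'I_D.+1 & 'I_B.+1 | Scan of 'I_D.+1 | RewindOne of 'I_D.+1
  | Query | Answer of bool.
Arguments CopyFlag {D B}.
Arguments CopyBit {D B}.
Arguments RewindAll {D B}.
Arguments Enter {D B}.
Arguments Scan {D B}.
Arguments RewindOne {D B}.
Arguments Query {D B}.
Arguments Answer {D B}.

Definition gphase_enc D B (q : gphase D B) :
    ('I_D.+1 * 'I_B.+1) + ('I_D.+1 + 'I_D.+1) + ('I_4 + bool) :=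
  match q with
  | Enter d r => inl (inl (d, r))
  | Scan d => inl (inr (inl d))
  | RewindOne d => inl (inr (inr d))
  | CopyFlag => inr (inl (inord 0))
  | CopyBit => inr (inl (inord 1))
  | RewindAll => inr (inl (inord 2))
  | Query => inr (inl (inord 3))
  | Answer b => inr (inr b)
  end.

Definition gphase_dec D B
    (i : ('I_D.+1 * 'I_B.+1) + ('I_D.+1 + 'I_D.+1) + ('I_4 + bool)) :
    gphase D B :=
  match i with
  | inl (inl (d, r)) => Enter d r
  | inl (inr (inl d)) => Scan d
  | inl (inr (inr d)) => RewindOne d
  | inr (inl i) => nth Query [:: CopyFlag; CopyBit; RewindAll] i
  | inr (inr b) => Answer b
  end.

Lemma gphase_encK D B : cancel (@gphase_enc D B) (@gphase_dec D B).
Proof. by case=> //=; rewrite inordK. Qed.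

HB.instance Definition _ D B :=
  Finite.copy (gphase D B) (can_type (@gphase_encK D B)).

Definition working D B (q : gphase D B) : bool :=
  match q with Query | Answer _ => false | _ => true end.

Section GuessMachine.

Variable s : seq nat.
Notation D := (size s).
Notation B := (sumn s).
Notation phase := (gphase (size s) (sumn s)).
Notation sym := (symbol void).
Notation act := (symbol void * move)%type.
Notation counter := 'I_(size s).+1.

(** With [s] the coefficients a_0, a_1, ..., level [d] writes a_d letters and then runs level
    [d + 1] once per letter of [x]: this is the Horner scheme. Past the last coefficient the default
    0 is used. *)
Definition enter (d : nat) : phase := Enter (inord d) (inord (nth 0 s d)).

(** Each level has a single caller, so the level alone determines where to resume: the scan of the
    enclosing level, or the query. *)
Definition leave (d : nat) : phase :=
  if d is d'.+1 then Scan (inord d') else Query.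

(** With the guessed bit as an argument the machine is a function. In [RewindAll] the counter heads
    move together, so watching one of them suffices. *)
Definition guess_trans (g : bool) (q : phase) (si sq : sym)
    (sc : counter -> sym) : phase * (act * act * (counter -> act)) :=
  let keep := fun i => (sc i, Stay) in
  let all_move m := fun i => (sc i, m) in
  let one_move d m := fun i => (sc i, if i == d then m else Stay) in
  match q with
  | CopyFlag =>
      match si with
      | Bit _ => (CopyBit, ((si, Stay), (Bit true, MoveR), keep))
      | _ => (RewindAll, ((si, Stay), (Bit false, MoveR), all_move MoveL))
      end
  | CopyBit => (CopyFlag, ((si, MoveR), (si, MoveR), fun=> (si, MoveR)))
  | RewindAll =>
      match sc ord0 with
      | Blank => (enter 0, ((si, Stay), (sq, Stay), all_move MoveR))
      | _ => (RewindAll, ((si, Stay), (sq, Stay), all_move MoveL))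
      end
  | Enter d r =>
      if val r is r'.+1 then
        (Enter d (inord r'), ((si, Stay), (Bit g, MoveR), keep))
      else
        (if val d == D then leave d else Scan d,
         ((si, Stay), (sq, Stay), keep))
  | Scan d =>
      match sc d with
      | Blank => (RewindOne d, ((si, Stay), (sq, Stay), one_move d MoveL))
      | _ => (enter d.+1, ((si, Stay), (sq, Stay), one_move d MoveR))
      end
  | RewindOne d =>
      match sc d with
      | Blank => (leave d, ((si, Stay), (sq, Stay), one_move d MoveR))
      | _ => (RewindOne d, ((si, Stay), (sq, Stay), one_move d MoveL))
      end
  | _ => (q, ((si, Stay), (sq, Stay), keep))
  end.

Definition guess_step (g : bool) (q : phase)
    (sc : {ffun bool + counter -> sym}) :
    phase * {ffun bool + counter -> act} :=
  let r := guess_trans g q (sc (inl true)) (sc (inl false))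
             (fun i => sc (inr i)) in
  (r.1, [ffun k => match k with
                   | inl true => r.2.1.1
                   | inl false => r.2.1.2
                   | inr i => r.2.2 i
                   end]).

Definition guess_ontm : ontm := {|
  ostate := phase;
  otape := (bool + counter)%type;
  owork := void;
  ostart := CopyFlag;
  oinput := inl true;
  oquerytape := inl false;
  oquery := Query;
  oyes := Answer true;
  ono := Answer false;
  overdict := fun q => if q is Answer b then Some b else None;
  otrans := fun q sc q' a => exists g, (q', a) = guess_step g q sc
|}.

Notation conf := (oconfig guess_ontm).

Definition gconf (q : phase) (ti tq : tape void) (tc : counter -> tape void) :
    conf :=
  @Config (ostate guess_ontm) (otape guess_ontm) (owork guess_ontm) q
    (fun k => match k with
     | inl true => ti
     | inl false => tq
     | inr i => tc i
     end).

(** * Paths with explicit guesses *)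

Definition fstep (g : bool) (c : conf) : conf :=
  if working (state c : phase) then
    let r := guess_step g (state c) (scan c) in update c r.1 r.2
  else c.

(* Unlike [osteps], these steps idle on the query and answer states. *)
Fixpoint fsteps (n : nat) (c c' : conf) : Prop :=
  if n is n'.+1 then exists g, fsteps n' (fstep g c) c' else c' = c.

Lemma gconf_fstep g q ti tq tc :
  working q ->
  let r := guess_trans g q (read ti) (read tq) (fun i => read (tc i)) in
  fstep g (gconf q ti tq tc) =
  gconf r.1 (write_move r.2.1.1 ti) (write_move r.2.1.2 tq)
    (fun i => write_move (r.2.2 i) (tc i)).
Proof.
move=> wq r; rewrite /fstep /= wq /guess_step.
have e : guess_trans g q (scan (gconf q ti tq tc) (inl true))
  (scan (gconf q ti tq tc) (inl false))
  (fun i => scan (gconf q ti tq tc) (inr i)) = r.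
  rewrite /r !ffunE; congr guess_trans.
  by apply: functional_extensionality => i; rewrite ffunE.
rewrite e /update /gconf; congr Config.
by apply: functional_extensionality => -[[]|i]; rewrite /= !ffunE.
Qed.

Lemma fsteps_add m n c c'' :
  fsteps (m + n) c c'' <-> exists2 c', fsteps m c c' & fsteps n c' c''.
Proof.
elim: m c => [|m IH] c /=.
  by split=> [h|[c' -> //]]; exists c.
split=> [[g /IH [c' h1 h2]]|[c' [g h1] h2]].
  by exists c' => //; exists g.
by exists g; apply/IH; exists c'.
Qed.

Lemma fsteps_idle n c : ~~ working (state c : phase) -> fsteps n c c.
Proof.
move=> nw; elim: n => //= n IH; exists true.
by rewrite /fstep (negbTE nw).
Qed.

Lemma fsteps_idle_eq n c c' :
  ~~ working (state c : phase) -> fsteps n c c' -> c' = c.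
Proof.
move=> nw; elim: n => //= n IH [g]; rewrite /fstep (negbTE nw); exact: IH.
Qed.

Lemma fsteps_det n c c1 c' :
  (forall g, fstep g c = c1) -> fsteps n.+1 c c' <-> fsteps n c1 c'.
Proof.
move=> h; split=> [[g]|h1]; first by rewrite h.
by exists true; rewrite h.
Qed.

Lemma ostep_fstep (A : language) (c : conf) g :
  working (state c : phase) -> ostep A c (fstep g c).
Proof.
move=> w; rewrite /fstep w; apply: OWork.
- by move: w; rewrite /=; case: (state c : phase).
- by move=> e; move: w; rewrite e.
- by exists g; case: (guess_step _ _ _).
Qed.

Lemma ostep_working (A : language) (c c' : conf) :
  ostep A c c' -> working (state c : phase) -> exists g, c' = fstep g c.
Proof.
move=> st w; case: st.
- by move=> q a _ _ [g e]; exists g; rewrite /fstep w -e.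
- by move=> v _ e; move: w; rewrite e.
- by move=> v _ e; move: w; rewrite e.
Qed.

Lemma guess_trans_not_answer g q si sq sc b :
  working q -> (guess_trans g q si sq sc).1 <> Answer b.
Proof.
have lv d : leave d <> Answer b by case: d.
case: q => //=.
- by case: si.
- by case: (sc _).
- by move=> d [[|r] hr] _ //=; case: ifP.
- by move=> d; case: (sc d).
- by move=> d; case: (sc d) => /=.
Qed.

Lemma fstep_not_answer g (c : conf) b :
  working (state c : phase) -> state (fstep g c) <> Answer b.
Proof. by move=> w; rewrite /fstep w /=; apply: guess_trans_not_answer. Qed.

Lemma osteps_add (A : language) (c c'' : conf) m n :
  osteps A c (m + n) c'' -> exists2 c', osteps A c m c' & osteps A c' n c''.
Proof.
elim: n c'' => [|n IH] c''.
  by rewrite addn0; exists c''; last exact: osteps0.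
rewrite addnS => h; inversion h as [|k c1 c2 h1 h2]; subst.
by have [c' hm hn] := IH _ h1; exists c' => //; apply: ostepsS hn h2.
Qed.

Lemma osteps1 (A : language) (c c' : conf) : osteps A c 1 c' -> ostep A c c'.
Proof.
by move=> h; inversion h as [|k c1 c2 h1 h2]; subst; inversion h1; subst.
Qed.

Lemma osteps_front (A : language) (c c1 c' : conf) n :
  ostep A c c1 -> osteps A c1 n c' -> osteps A c n.+1 c'.
Proof.
move=> st; elim=> [|m c2 c3 _ IH st2]; first exact: ostepsS (osteps0 _ _) st.
exact: ostepsS IH st2.
Qed.

(** A query step leads to an answer, where the path ends; a path that ends elsewhere consists of
    working steps. *)
Lemma osteps_fsteps (A : language) (c c' : conf) n :
  osteps A c n c' -> (forall b, state c' <> Answer b) -> fsteps n c c'.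
Proof.
elim=> [//|m c1 c2 _ IH st na].
have w : working (state c1 : phase).
  case: st na => [q a|v|v].
  - rewrite /=; case: (state c1 : phase) => //.
  - by move=> _ _ _ _ /(_ true).
  - by move=> _ _ _ _ /(_ false).
have [g ->] := ostep_working st w.
rewrite -addn1; apply/fsteps_add; exists c1; last by exists g.
by apply: IH => b e; move: w; rewrite e.
Qed.

(** Idle steps are dropped, so [m] may be smaller than [n]. *)
Lemma fsteps_osteps (A : language) (c c' : conf) n :
  fsteps n c c' -> state c' = Query -> exists m, osteps A c m c'.
Proof.
elim: n c => [|n IH] c; first by move=> -> _; exists 0; exact: osteps0.
case: (boolP (working (state c : phase))) => [w|nw] h q'; last first.
  by rewrite (fsteps_idle_eq nw h); exists 0; exact: osteps0.
case: h => g /IH /(_ q') [m h]; exists m.+1.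
exact: osteps_front (ostep_fstep A g w) h.
Qed.

Lemma nth_le_sumn d : nth 0 s d <= B.
Proof.
elim: s d => [|a r IH] [|d] //=; first exact: leq_addr.
exact: leq_trans (IH d) (leq_addl _ _).
Qed.

(** * Nested loops and the number of guessed letters *)

Section Loop.

Variables (x : word) (ti : tape void).
Notation n := (size x).

Definition lconf (q : phase) (u : word) (h : counter -> int) : conf :=
  gconf q ti (tape_zip (word_symbols void u) [::])
    (fun i => tape_at (word_symbols void x) (h i)).

Definition set_head (h : counter -> int) (d : counter) (j : int) :=
  fun i => if i == d then j else h i.

(** The equivalence carries soundness, completeness and exact timing at once; quantifying over [u]
    lets such statements be chained. *)
Definition guesses q h T q' h' v := forall u c',
  fsteps T (lconf q u h) c' <->
  exists2 g, size g = v & c' = lconf q' (u ++ g) h'.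

Lemma guesses_trans q1 h1 T1 v1 q2 h2 T2 v2 q3 h3 :
  guesses q1 h1 T1 q2 h2 v1 -> guesses q2 h2 T2 q3 h3 v2 ->
  guesses q1 h1 (T1 + T2) q3 h3 (v1 + v2).
Proof.
move=> H1 H2 u c'; split=> [/fsteps_add [c1 /H1 [g1 s1 ->] /H2 [g2 s2 ->]]|].
  by exists (g1 ++ g2); rewrite ?size_cat ?s1 ?s2 // catA.
case=> g sg ->; apply/fsteps_add; exists (lconf q2 (u ++ take v1 g) h2).
  by apply/H1; exists (take v1 g) => //; rewrite size_takel // sg leq_addr.
apply/H2; exists (drop v1 g); first by rewrite size_drop sg addKn.
by rewrite -catA cat_take_drop.
Qed.

Lemma guesses_silent q h q' h' :
  (forall g u, fstep g (lconf q u h) = lconf q' u h') ->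
  guesses q h 1 q' h' 0.
Proof.
move=> H u c'; rewrite (@fsteps_det 0 _ (lconf q' u h')) //=.
split=> [->|[g /size0nil -> ->]]; last by rewrite cats0.
by exists [::]; rewrite ?cats0.
Qed.

Lemma guesses_bit q h q' :
  (forall g u, fstep g (lconf q u h) = lconf q' (rcons u g) h) ->
  guesses q h 1 q' h 1.
Proof.
move=> H u c' /=; split=> [[g ->]|[g sg ->]].
  by exists [:: g]; rewrite // H cats1.
by case: g sg => [|g []] // _; exists g; rewrite H cats1.
Qed.

Lemma guesses_refl q h : guesses q h 0 q h 0.
Proof.
move=> u c' /=; split=> [->|[g /size0nil -> ->]]; last by rewrite cats0.
by exists [::]; rewrite ?cats0.
Qed.

Lemma lconf_eq q u h ti' tq' tc' :
  ti' = ti -> tq' = tape_zip (word_symbols void u) [::] ->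
  (forall i, tc' i = tape_at (word_symbols void x) (h i)) ->
  gconf q ti' tq' tc' = lconf q u h.
Proof.
move=> -> -> e; congr (gconf _ _ _).
exact: functional_extensionality.
Qed.

Lemma guesses_enter (d : counter) r h :
  r <= B -> guesses (Enter d (inord r)) h r (Enter d (inord 0)) h r.
Proof.
elim: r => [|r IH] leB; first exact: guesses_refl.
rewrite -add1n; apply: guesses_trans (IH (ltnW leB)).
apply: guesses_bit => g u; rewrite gconf_fstep //= inordK //=.
apply: lconf_eq => [||i]; rewrite ?write_stay //.
by rewrite zip_append word_symbols_rcons.
Qed.

Lemma set_head_eq h d j : set_head h d j d = j.
Proof. by rewrite /set_head eqxx. Qed.

Lemma set_head_id h d : set_head h d (h d) = h.
Proof.
by apply: functional_extensionality => i; rewrite /set_head; case: eqP => [->|].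
Qed.

Lemma write_one_head h d j m i :
  write_move
    (read (tape_at (word_symbols void x) (set_head h d j i)),
     if i == d then m else Stay)
    (tape_at (word_symbols void x) (set_head h d j i)) =
  tape_at (word_symbols void x) (set_head h d (shift m j) i).
Proof.
rewrite /set_head; case: eqP => _; last exact: write_stay.
exact: step_headE.
Qed.

Lemma read_word_bit j : j < n ->
  exists b, read (tape_at (word_symbols void x) j) = Bit b.
Proof.
by move=> ltj; exists (nth false x j); rewrite read_tape_at (nth_map false).
Qed.

Lemma guesses_rewind_one h d k : k <= n ->
  guesses (RewindOne d) (set_head h d (k%:Z - 1)%R) k.+1
    (leave d) (set_head h d 0%R) 0.
Proof.
elim: k => [|k IH] lek.
  apply: guesses_silent => g u; rewrite gconf_fstep //= set_head_eq.
  apply: lconf_eq => [||i]; rewrite ?write_stay //; exact: write_one_head.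
apply: (@guesses_trans _ _ 1 0 _ _ _ 0 _ _ _ (IH (ltnW lek))).
apply: guesses_silent => g u; rewrite gconf_fstep //= subz1 set_head_eq.
have [b ->] := read_word_bit lek.
apply: lconf_eq => [||i]; rewrite ?write_stay //; exact: write_one_head.
Qed.

(** One step notices the blank behind [x], and n + 1 steps rewind. *)
Lemma guesses_scan_end h d :
  guesses (Scan d) (set_head h d n) n.+2 (leave d) (set_head h d 0%R) 0.
Proof.
apply: (@guesses_trans _ _ 1 0 _ _ _ 0 _ _ _
          (guesses_rewind_one h d (leqnn n))).
apply: guesses_silent => g u; rewrite gconf_fstep //= set_head_eq.
have -> : read (tape_at (word_symbols void x) n) = Blank.
  by rewrite read_tape_at nth_default // size_map.
apply: lconf_eq => [||i]; rewrite ?write_stay //; exact: write_one_head.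
Qed.

Lemma guesses_scan_bit h d j : j < n ->
  guesses (Scan d) (set_head h d j) 1 (enter d.+1) (set_head h d j.+1) 0.
Proof.
move=> ltj; apply: guesses_silent => g u.
rewrite gconf_fstep //= set_head_eq.
have [b ->] := read_word_bit ltj.
apply: lconf_eq => [||i]; rewrite ?write_stay //= write_one_head.
by rewrite /= -addn1 PoszD.
Qed.

(** In order: the [a] guesses, the switch to scanning, [n] rounds of one step and an inner loop
    each, and the closing rewind. *)
Fixpoint loop_time (r : seq nat) : nat :=
  if r is a :: r' then a + (1 + (n * (1 + loop_time r') + n.+2)) else 1.

(** Every loop returns the heads of its own and deeper levels to cell 0, which is what allows the
    enclosing loop to run it again. *)
Lemma guesses_loop r d h :
  drop d s = r -> d + size r = D -> (forall i : counter, d <= i -> h i = 0%R) ->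
  guesses (enter d) h (loop_time r) (leave d) h (horner_rec r n).
Proof.
elim: r d h => [|a r IH] d h dr sd h0.
  rewrite addn0 in sd; apply: guesses_silent => g u.
  (* Beyond the last coefficient nothing is guessed and the test against [D] returns at once. *)
  rewrite gconf_fstep //= inordK ?nth_default ?inordK ?sd ?eqxx //=.
  by apply: lconf_eq => [||i]; rewrite ?write_stay.
have ltd : d < D by rewrite -sd addnS ltnS leq_addr.
have [na dr'] : nth 0 s d = a /\ drop d.+1 s = r.
  by move: dr; rewrite (drop_nth 0) // => -[-> ->].
set dd : counter := inord d.
have vd : dd = d :> nat by rewrite inordK // ltnW.
(* One summand per phase; the zeros belong to the silent switch and rewind. *)
have -> : horner_rec (a :: r) n = a + (0 + (n * horner_rec r n + 0)).
  by rewrite /= add0n addn0 addnC mulnC.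
rewrite /enter na; apply: guesses_trans.
  by apply: guesses_enter; rewrite -na nth_le_sumn.
apply: guesses_trans.
  apply: (@guesses_silent _ _ (Scan dd) h) => g u.
  rewrite gconf_fstep //= inordK //= -/dd vd ltn_eqF //.
  by apply: lconf_eq => [||i]; rewrite ?write_stay.
(* Inner induction on the number [k] of letters still to be scanned. *)
have iter k : k <= n ->
    guesses (Scan dd) (set_head h dd (n - k)%N) (k * (1 + loop_time r))
      (Scan dd) (set_head h dd n) (k * horner_rec r n).
  elim: k => [|k IHk] lek; first by rewrite subn0; exact: guesses_refl.
  rewrite !mulSn; apply: guesses_trans (IHk (ltnW lek)).
  rewrite -[horner_rec r n]add0n; apply: guesses_trans.
    by apply: guesses_scan_bit; rewrite ltn_subrL (leq_trans _ lek).
  rewrite vd; have -> : (n - k.+1).+1 = n - k by lia.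
  (* [leave d.+1] computes to [Scan dd], where the next round starts. *)
  apply: IH => //; first by rewrite -sd addSnnS.
  move=> i lei; rewrite /set_head; case: eqP => [e|_].
    by move: lei; rewrite e vd ltnn.
  by apply: h0; exact: ltnW.
have hd : h = set_head h dd 0%R.
  by rewrite -(h0 dd) ?vd // set_head_id.
have := iter n (leqnn n); rewrite subnn -hd => loop.
apply: guesses_trans loop _.
by have := guesses_scan_end h dd; rewrite -hd vd.
Qed.

End Loop.

(** * From the initial configuration to the query *)

Lemma fsteps_copy x1 x2 u pre T : exists ti, forall c',
  fsteps ((size x2).*2.+1 + T)
    (gconf CopyFlag (tape_zip pre (word_symbols void x2))
       (tape_zip (word_symbols void u) [::])
       (fun=> tape_zip (word_symbols void x1) [::])) c' <->
  fsteps T (lconf (x1 ++ x2) ti RewindAll (u ++ code x2)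
    (fun=> (size (x1 ++ x2))%:Z - 1)%R) c'.
Proof.
elim: x2 x1 u pre => [|b x2 IH] x1 u pre.
  exists (tape_zip pre [::]) => c'; apply: fsteps_det => g.
  rewrite gconf_fstep // (read_zip_nil pre) /=.
  apply: lconf_eq => [||i].
  - by rewrite -(read_zip_nil pre) write_stay.
  - by rewrite zip_append -word_symbols_rcons cats1.
  - by rewrite zip_left_end cats0 size_map.
have [ti H] := IH (rcons x1 b) (u ++ [:: true; b]) (rcons pre (Bit b)).
exists ti => c'; move: {H}(H c'); rewrite cat_rcons -catA => <-.
rewrite -[(size (b :: x2)).*2.+1 + T]/((size x2).*2.+1 + T).+2.
have step1 g : fstep g (gconf CopyFlag
    (tape_zip pre (word_symbols void (b :: x2)))
    (tape_zip (word_symbols void u) [::])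
    (fun=> tape_zip (word_symbols void x1) [::])) =
  gconf CopyBit (tape_zip pre (word_symbols void (b :: x2)))
    (tape_zip (word_symbols void (rcons u true)) [::])
    (fun=> tape_zip (word_symbols void x1) [::]).
  rewrite gconf_fstep // (read_zip_cons pre) /= -{1}(read_zip_cons pre
    (word_symbols void x2) (Bit b)) write_stay zip_append word_symbols_rcons.
  congr (gconf _ _ _).
  by apply: functional_extensionality => i; rewrite write_stay.
rewrite (fsteps_det _ _ step1).
apply: fsteps_det => g; rewrite gconf_fstep // (read_zip_cons pre) /=.
rewrite zip_right !zip_append -!word_symbols_rcons -!cats1 -catA.
by [].
Qed.

Lemma fsteps_rewind_all x ti u T k c' : k <= size x ->
  fsteps (k.+1 + T) (lconf x ti RewindAll u (fun=> k%:Z - 1)%R) c' <->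
  fsteps T (lconf x ti (enter 0) u (fun=> 0%R)) c'.
Proof.
elim: k => [|k IH] lek.
  apply: fsteps_det => g; rewrite gconf_fstep //=.
  by apply: lconf_eq => [||i]; rewrite ?write_stay ?write_right_blank.
rewrite -(IH (ltnW lek)); apply: fsteps_det => g.
rewrite gconf_fstep // subz1 /=.
have [b eb] := read_word_bit lek; rewrite eb.
by apply: lconf_eq => [||i]; rewrite ?write_stay //= -eb write_left.
Qed.

Definition query_time (x : word) : nat :=
  (size x).*2.+1 + ((size x).+1 + loop_time x s).

(** Copying, rewinding and looping take a time that depends on |x| alone, so all paths reach the
    query together and differ only in the guessed word. *)
Lemma fsteps_query x : exists ti, forall c',
  fsteps (query_time x) (oinit guess_ontm x) c' <->
  exists2 g, size g = horner_rec s (size x) &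
    c' = lconf x ti Query (code x ++ g) (fun=> 0%R).
Proof.
have -> : oinit guess_ontm x =
  gconf CopyFlag (tape_zip [::] (word_symbols void x))
    (tape_zip (word_symbols void [::]) [::])
    (fun=> tape_zip (word_symbols void [::]) [::]).
  rewrite /oinit /initial /gconf; congr Config.
  by apply: functional_extensionality => -[[]|i].
have [ti H] := fsteps_copy [::] x [::] [::] ((size x).+1 + loop_time x s).
exists ti => c'; rewrite H fsteps_rewind_all //.
by apply: guesses_loop; rewrite ?drop0.
Qed.

(** * The query step and acceptance *)

Lemma query_word_zip (u : word) :
  query_word (tape_zip (word_symbols void u) [::]) u.
Proof.
rewrite /tape_zip cats0; split=> [k ltk|b] /=.
  by rewrite (nth_map false).
by rewrite nth_default // size_map.
Qed.

(** Were the lengths different, the shorter block would be followed by a bit. *)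
Lemma query_word_inj (t : tape void) (u v : word) :
  query_word t u -> query_word t v -> u = v.
Proof.
move=> [u1 u2] [v1 v2].
have suv : size u = size v.
  case: (ltngtP (size u) (size v)) => // h.
  - by case: (u2 _ (v1 _ h)).
  - by case: (v2 _ (u1 _ h)).
apply: (@eq_from_nth _ false) => // i lti.
by have := u1 i lti; rewrite v1 -?suv // => -[].
Qed.

Lemma ostep_query (A : language) x ti u h c' :
  ostep A (lconf x ti Query u h) c' <->
  (A u /\ c' = lconf x ti (Answer true) u h) \/
  (~ A u /\ c' = lconf x ti (Answer false) u h).
Proof.
split=> [st|[[Au ->]|[Au ->]]].
- case: st => [//|w _ _ hw Aw|w _ _ hw Aw];
    rewrite -(query_word_inj hw (query_word_zip u)).
    by left.
  by right.
- exact: (@OYes A guess_ontm (lconf x ti Query u h) u erefl erefl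
            (query_word_zip u) Au).
- exact: (@ONo A guess_ontm (lconf x ti Query u h) u erefl erefl
            (query_word_zip u) Au).
Qed.

(** A longer path would contain the query step and then a step out of an answer state, which
    halts. *)
Lemma osteps_leq_query_time (A : language) x n c :
  osteps A (oinit guess_ontm x) n c -> n <= (query_time x).+1.
Proof.
move=> h; rewrite leqNgt; apply/negP => lt.
have [ti H] := fsteps_query x.
move: h; rewrite -(subnKC (ltnW (ltnW lt))) => /osteps_add [c1 h1].
have -> : n - query_time x = 1 + (1 + (n - query_time x - 2)) by lia.
move=> /osteps_add [c2 /osteps1 st2 /osteps_add [c3 /osteps1 st3 _]].
have /H [g sg e] : fsteps (query_time x) (oinit guess_ontm x) c1.
  apply: osteps_fsteps h1 _ => b e.
  by case: st2 => [q a|w|w]; rewrite e.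
rewrite {}e in st2; case/ostep_query: st2 => -[_ e]; rewrite e in st3;
  by inversion st3.
Qed.

Lemma accepts_guess (A : language) x :
  accepts A guess_ontm x <->
  exists2 g, size g = horner_rec s (size x) & A (code x ++ g).
Proof.
have [ti H] := fsteps_query x; split=> [[n [c [h v]]]|[g sg Ag]]; last first.
  have /H /(fsteps_osteps A) [//|m h] : exists2 g0,
      size g0 = horner_rec s (size x) &
      lconf x ti Query (code x ++ g) (fun=> 0%R) =
      lconf x ti Query (code x ++ g0) (fun=> 0%R) by exists g.
  exists m.+1, (lconf x ti (Answer true) (code x ++ g) (fun=> 0%R)); split=> //.
  by apply: ostepsS h _; apply/ostep_query; left.
have len := osteps_leq_query_time h.
inversion h as [e0 e1|m c1 c2 h1 st e0 e1]; subst; first by [].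
(* Working steps never produce an answer and answers have no successor, so the last step starts at
   the query. *)
have nw : ~~ working (state c1 : gphase _ _).
  apply/negP => w; have [g e] := ostep_working st w.
  have := @fstep_not_answer g _ true w; rewrite -e.
  by move: v => /=; case: (state c : gphase _ _) => // -[].
have na b : state c1 <> Answer b by move=> e; case: st => [q a|w|w]; rewrite e.
(* Idling at the query fills the path up to exactly [query_time x] steps. *)
have f1 : fsteps (query_time x) (oinit guess_ontm x) c1.
  rewrite -(subnKC (len : m <= query_time x)); apply/fsteps_add; exists c1.
    exact: osteps_fsteps h1 na.
  exact: fsteps_idle.
case/H: f1 => g sg e; exists g => //; rewrite {}e in st.
by case/ostep_query: st => -[] // _ e; rewrite e in v.
Qed.

End GuessMachine.

(** * The polynomial time bound and the conclusion *)

Fixpoint loop_time_poly (r : seq nat) : {poly nat} :=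
  if r is a :: r' then ((a + 3)%N%:P + 'X * (loop_time_poly r' + 2%:P))%R
  else 1%:P%R.

(** The constants come from regrouping a + 1 + n (1 + T) + n + 2 as (a + 3) + n (T + 2). *)
Lemma loop_time_polyE r x : peval (loop_time_poly r) (size x) = loop_time x r.
Proof.
rewrite /peval; elim: r => [|a r IH] /=; first by rewrite hornerC.
rewrite hornerD hornerM hornerX hornerD !hornerC IH.
by rewrite -[GRing.add _ _]/(addn _ _) -[GRing.mul _ _]/(muln _ _)
  -[GRing.add _ _]/(addn _ _); lia.
Qed.

Theorem theorem5 (L : language) : ParityP L -> NP_oracle MNS L.
Proof.
case=> p [R [polyR LR]].
(* By the choice of padding, witnesses are as long as the query word, hence the polynomial ['X]. *)
pose A : language := fun w =>
  exists t : nat, 1 <= t /\ witness_count 'X (padded R) w = 2 ^ t - 1.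
exists A; split.
  by exists 'X%R, (padded R); split=> //; exact: polytime_padded.
exists (guess_ontm (polyseq p)).
(* Copying takes 2n + 1 steps, rewinding n + 1 and the query one, besides the loops. *)
exists (3%:P * 'X + 3%:P + loop_time_poly (polyseq p))%R; split=> [x n c h|x].
  apply: leq_trans (osteps_leq_query_time h) _.
  have := loop_time_polyE (polyseq p) x.
  rewrite /peval !hornerD hornerM !hornerC hornerX => ->.
  rewrite -![GRing.add _ _]/(addn _ _) -[GRing.mul _ _]/(muln _ _) /query_time.
  by lia.
have cntR : witness_count p R x = wcount (peval p (size x)) (R x).
  exact: card_tuple_wcount.
rewrite LR accepts_guess cntR (odd_iff_lt_even_completion (wcount_le _ _)).
have cntA g : size g = peval p (size x) ->
    witness_count 'X (padded R) (code x ++ g) =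
    wcount (peval p (size x)) (R x) + wcount (peval p (size x)) (lt_even g).
  move=> sg; rewrite /witness_count card_tuple_wcount /peval hornerX.
  by rewrite wcount_padded sg.
split=> [[g [sg [t [t1 e]]]]|[g sg [t [t1 e]]]].
  by exists g => //; exists t; rewrite cntA.
by exists g; split=> //; exists t; rewrite -cntA.
Qed.
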